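(* Let $d\ge 2$ be a constant. If $G$ is a tree with $n$ vertices and maximum vertex degree $d$, then $$D_2(G) < c_d\log n + d + 2,\qquad\text{where } c_d=\frac{d+1}{\log(3/2)}+1.$$
   Context: All graphs are finite simple graphs. A graph is regarded as a structure with one anti-reflexive symmetric binary relation $E$ (adjacency). First-order formulas are over the vocabulary $\{E,=\}$, with connectives $\neg,\wedge,\vee$ and quantifiers $\exists,\forall$. The quantifier rank of a formula is the maximum number of nested quantifiers in it. For a formula $\Phi$, its set of sequences of nested quantifiers $\mathrm{nest}(\Phi)$ (words over $\{\exists,\forall\}$) is defined inductively: - $\mathrm{nest}(\Phi)=\{\text{empty word}\}$ for atomic $\Phi$; - $\mathrm{nest}(\neg\Phi)$ is $\mathrm{nest}(\Phi)$ with $\exists$ and $\forall$ interchanged in every word; - $\mathrm{nest}(\Phi\wedge\Psi)=\mathrm{nest}(\Phi\vee\Psi)=\mathrm{nest}(\Phi)\cup\mathrm{nest}(\Psi)$; - $\mathrm{nest}(\exists x\Phi)=\exists\,\mathrm{nest}(\Phi)$ and $\mathrm{nest}(\forall x\Phi)=\forall\,\mathrm{nest}(\Phi)$. The alternation number of $\Phi$ is the maximum, over words $s\in\mathrm{nest}(\Phi)$, of the number of occurrences of $\exists\forall$ and $\forall\exists$ as consecutive letters in $s$. A closed formula $\Phi$ defines a graph $G$ if $\Phi$ is true on $G$ and false on every graph not isomorphic to $G$. $D_k(G)$ denotes the minimum quantifier rank of a formula with alternation number at most $k$ that defines $G$. $\log$ denotes the logarithm to base 2. *)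

(* Defs.v *)
From HB Require Import structures.
From mathcomp Require Import all_boot all_order all_algebra.
From mathcomp Require Import reals exp.

Set Implicit Arguments.
Unset Strict Implicit.
Unset Printing Implicit Defensive.

Record sgraph := SGraph {
  vertex :> finType;
  adj : rel vertex;
  adj_sym : symmetric adj;
  adj_irrefl : irreflexive adj }.

Definition isomorphic (G H : sgraph) : Prop :=
  exists2 f : G -> H, bijective f & forall x y, adj (f x) (f y) = adj x y.

Definition is_connected (G : sgraph) : Prop :=
  (0 < #|G|)%N /\ forall x y : G, connect (@adj G) x y.

(* Cycles have at least three vertices: in MathComp, [:: x; y] is an
   adj-cycle as soon as x and y are adjacent. *)
Definition is_acyclic (G : sgraph) : Prop :=
  forall c : seq G, (2 < size c)%N -> ~ ucycle (@adj G) c.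

Definition is_tree (G : sgraph) : Prop := is_connected G /\ is_acyclic G.

Definition degree (G : sgraph) (x : G) : nat := #|[set y | adj x y]|.

Definition max_degree (G : sgraph) : nat := \max_(x : G) degree x.

(* First-order formulas whose free variables range over the type V.
   A quantifier binds the fresh variable None : option V and renames each
   variable x : V into Some x. A closed formula has no free variables, hence
   lives over void, so that it can be evaluated on every graph, including the
   one without vertices. *)
Inductive formula (V : Type) : Type :=
  | Eq of V & V
  | Adj of V & V
  | Neg of formula V
  | And of formula V & formula V
  | Or of formula V & formula V
  | Ex of formula (option V)
  | All of formula (option V).

Definition sentence := formula void.

Definition extend (T V : Type) (e : V -> T) (a : T) : option V -> T :=
  fun x => if x is Some y then e y else a.

Fixpoint eval (G : sgraph) (V : Type) (e : V -> G) (F : formula V) : bool :=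
  match F with
  | Eq x y => e x == e y
  | Adj x y => adj (e x) (e y)
  | Neg F1 => ~~ eval e F1
  | And F1 F2 => eval e F1 && eval e F2
  | Or F1 F2 => eval e F1 || eval e F2
  | Ex F1 => [exists a, eval (extend e a) F1]
  | All F1 => [forall a, eval (extend e a) F1]
  end.

Definition models (G : sgraph) (F : sentence) : bool :=
  eval (of_void G) F.

Fixpoint quantifier_rank (V : Type) (F : formula V) : nat :=
  match F with
  | Eq _ _ | Adj _ _ => 0
  | Neg F1 => quantifier_rank F1
  | And F1 F2 | Or F1 F2 => maxn (quantifier_rank F1) (quantifier_rank F2)
  | Ex F1 | All F1 => (quantifier_rank F1).+1
  end.

(* Words over the two quantifiers: true is the existential letter and false
   the universal one. *)
Fixpoint nest (V : Type) (F : formula V) : seq (seq bool) :=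
  match F with
  | Eq _ _ | Adj _ _ => [:: [::]]
  | Neg F1 => map (map negb) (nest F1)
  | And F1 F2 | Or F1 F2 => nest F1 ++ nest F2
  | Ex F1 => map (cons true) (nest F1)
  | All F1 => map (cons false) (nest F1)
  end.

Fixpoint alternations (s : seq bool) : nat :=
  match s with
  | q1 :: ((q2 :: _) as s') => (q1 != q2) + alternations s'
  | _ => 0
  end.

Definition alternation_number (V : Type) (F : formula V) : nat :=
  \max_(s <- nest F) alternations s.

Definition defines (F : sentence) (G : sgraph) : Prop :=
  models G F /\ forall H : sgraph, ~ isomorphic G H -> ~~ models H F.

Definition definable_with (k q : nat) (G : sgraph) : Prop :=
  exists F : sentence,
    [/\ defines F G, (alternation_number F <= k)%N & quantifier_rank F = q].

(* is_D k G q states that the minimum D_k(G) exists and equals q. *)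
Definition is_D (k : nat) (G : sgraph) (q : nat) : Prop :=
  definable_with k q G /\ forall r, definable_with k r G -> (q <= r)%N.

Local Open Scope ring_scope.

Definition log2 (R : realType) (x : R) : R := ln x / ln 2.

Definition c_ (R : realType) (d : nat) : R := (d%:R + 1) / log2 (3 / 2 : R) + 1.

(* Main.v *)
Require Import Defs.
From mathcomp Require Import all_boot all_order all_algebra.
From mathcomp Require Import reals exp.
From mathcomp Require Import boolp lra.

Set Implicit Arguments.
Unset Strict Implicit.
Unset Printing Implicit Defensive.
Import Order.TTheory GRing.Theory Num.Theory.
Local Open Scope nat_scope.

(** The defining sentence says that [H] is connected and that there is a locally
    bijective homomorphism [G -> H], i.e. a covering. Such a covering of a
    connected [H] by a finite tree is an isomorphism: cycles of [H] would lift
    to [G], so [H] is acyclic, and a locally injective map to an acyclic graph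
    is injective on paths.

    The existence of the covering is expressed with few nested quantifiers by
    divide and conquer. A vertex [c] of the tree separates it into branches of
    at most half the size; the images of [c] and of its at most [d] neighbours
    are quantified, local bijectivity at [c] is stated, and the branches are
    treated in parallel. This takes about [(d + 1) log n] existential
    quantifiers, followed by a single universal one for local surjectivity. *)

(** * Renaming of variables *)

Definition option_ren (V W : Type) (h : V -> W) : option V -> option W :=
  extend (fun x => Some (h x)) None.

Fixpoint rename (V W : Type) (h : V -> W) (F : formula V) : formula W :=
  match F with
  | Eq x y => Eq (h x) (h y)
  | Adj x y => Adj (h x) (h y)
  | Neg F1 => Neg (rename h F1)
  | And F1 F2 => And (rename h F1) (rename h F2)
  | Or F1 F2 => Or (rename h F1) (rename h F2)
  | Ex F1 => Ex (rename (option_ren h) F1)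
  | All F1 => All (rename (option_ren h) F1)
  end.

Lemma quantifier_rank_rename (V W : Type) (h : V -> W) (F : formula V) :
  quantifier_rank (rename h F) = quantifier_rank F.
Proof.
elim: F W h => //= {}V F IH.
- by move=> F' IH' W h; rewrite IH IH'.
- by move=> F' IH' W h; rewrite IH IH'.
- by move=> W h; rewrite IH.
- by move=> W h; rewrite IH.
Qed.

Lemma nest_rename (V W : Type) (h : V -> W) (F : formula V) :
  nest (rename h F) = nest F.
Proof.
elim: F W h => //= {}V F IH.
- by move=> W h; rewrite IH.
- by move=> F' IH' W h; rewrite IH IH'.
- by move=> F' IH' W h; rewrite IH IH'.
- by move=> W h; rewrite IH.
- by move=> W h; rewrite IH.
Qed.

Lemma eq_eval (H : sgraph) (V : Type) (F : formula V) (e e' : V -> H) :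
  e =1 e' -> eval e F = eval e' F.
Proof.
have ext (W : Type) (e1 e2 : W -> H) a :
    e1 =1 e2 -> extend e1 a =1 extend e2 a by move=> ee [x|] /=.
elim: F e e' => {}V.
- by move=> x y e e' ee /=; rewrite !ee.
- by move=> x y e e' ee /=; rewrite !ee.
- by move=> F IH e e' ee /=; rewrite (IH e e').
- by move=> F IH F' IH' e e' ee /=; rewrite (IH e e') ?(IH' e e').
- by move=> F IH F' IH' e e' ee /=; rewrite (IH e e') ?(IH' e e').
- by move=> F IH e e' ee /=; apply: eq_existsb => a; apply/IH/ext.
- by move=> F IH e e' ee /=; apply: eq_forallb => a; apply/IH/ext.
Qed.

Lemma eval_rename (H : sgraph) (V W : Type) (h : V -> W) (F : formula V)
    (e : W -> H) :
  eval e (rename h F) = eval (e \o h) F.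
Proof.
have ext (V' W' : Type) (h' : V' -> W') (e' : W' -> H) a :
    extend e' a \o option_ren h' =1 extend (e' \o h') a by case.
elim: F W h e => {}V //=.
- by move=> F IH W h e; rewrite IH.
- by move=> F IH F' IH' W h e; rewrite IH IH'.
- by move=> F IH F' IH' W h e; rewrite IH IH'.
- by move=> F IH W h e; apply: eq_existsb => a; rewrite IH; apply/eq_eval/ext.
- by move=> F IH W h e; apply: eq_forallb => a; rewrite IH; apply/eq_eval/ext.
Qed.

(** * Properties definable with bounded rank and prescribed quantifier words *)

(** The predicate [A] records the shape of the nested quantifier words, since an alternation count
    alone does not tell how it changes when a quantifier is prefixed. *)
Definition definable (A : pred (seq bool)) (r : nat) (V : Type)
    (P : forall H : sgraph, (V -> H) -> Prop) : Prop :=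
  exists F : formula V, [/\ quantifier_rank F <= r, all A (nest F)
    & forall (H : sgraph) (e : V -> H), eval e F <-> P H e].

Section Definability.
Variables (A : pred (seq bool)) (V : Type).
Implicit Types P Q : forall H : sgraph, (V -> H) -> Prop.

Lemma definable_ext (r : nat) P Q :
  (forall H e, P H e <-> Q H e) -> definable A r P -> definable A r Q.
Proof.
move=> PQ [F [Fr FA FP]]; exists F; split=> // H e.
exact: iff_trans (FP H e) (PQ H e).
Qed.

Lemma definable_sub (B : pred (seq bool)) (r r' : nat) P :
  subpred A B -> r <= r' -> definable A r P -> definable B r' P.
Proof.
move=> AB rr' [F [Fr FA FP]]; exists F; split=> //; first exact: leq_trans rr'.
exact: sub_all FA.
Qed.

Lemma definable_rename (W : Type) (h : W -> V) (r : nat)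
    (P : forall H : sgraph, (W -> H) -> Prop) :
  definable A r P -> definable A r (fun H (e : V -> H) => P H (e \o h)).
Proof.
move=> [F [Fr FA FP]]; exists (rename h F).
by rewrite quantifier_rank_rename nest_rename; split=> // H e; rewrite eval_rename.
Qed.

Lemma definable_and (r : nat) P Q :
  definable A r P -> definable A r Q ->
  definable A r (fun H e => P H e /\ Q H e).
Proof.
move=> [F [Fr FA FP]] [F' [Fr' FA' FP']]; exists (And F F'); split=> /=.
- by rewrite geq_max Fr.
- by rewrite all_cat FA.
- by move=> H e; rewrite -FP -FP'; split=> /andP.
Qed.

Lemma definable_or (r : nat) P Q :
  definable A r P -> definable A r Q ->
  definable A r (fun H e => P H e \/ Q H e).
Proof.
move=> [F [Fr FA FP]] [F' [Fr' FA' FP']]; exists (Or F F'); split=> /=.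
- by rewrite geq_max Fr.
- by rewrite all_cat FA.
- by move=> H e; rewrite -FP -FP'; split=> /orP.
Qed.

Lemma definable_ex (B : pred (seq bool)) (r : nat)
    (P : forall H : sgraph, (option V -> H) -> Prop) :
  (forall s, A s -> B (true :: s)) -> definable A r P ->
  definable B r.+1 (fun H e => exists a : H, P H (extend e a)).
Proof.
move=> AB [F [Fr FA FP]]; exists (Ex F); split=> //=.
  by rewrite all_map; apply: sub_all FA.
by move=> H e; split=> [/existsP[a /FP Pa]|[a /FP Pa]]; [|apply/existsP]; exists a.
Qed.

Lemma definable_all (B : pred (seq bool)) (r : nat)
    (P : forall H : sgraph, (option V -> H) -> Prop) :
  (forall s, A s -> B (false :: s)) -> definable A r P ->
  definable B r.+1 (fun H e => forall a : H, P H (extend e a)).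
Proof.
move=> AB [F [Fr FA FP]]; exists (All F); split=> //=.
  by rewrite all_map; apply: sub_all FA.
move=> H e; split=> [/forallP eF a|eP]; first exact/FP.
by apply/forallP => a; apply/FP.
Qed.

Hypothesis A0 : A [::].

Lemma definable_eq (r : nat) (x y : V) :
  definable A r (fun H e => e x = e y).
Proof. by exists (Eq x y); split=> //= [|H e]; [rewrite A0|split=> /eqP]. Qed.

Lemma definable_neq (r : nat) (x y : V) :
  definable A r (fun H e => e x <> e y).
Proof. by exists (Neg (Eq x y)); split=> //= [|H e]; [rewrite A0|split=> /eqP]. Qed.

Lemma definable_adj (r : nat) (x y : V) :
  definable A r (fun H e => adj (e x) (e y)).
Proof. by exists (Adj x y); split=> //=; rewrite A0. Qed.

Lemma definable_nadj (r : nat) (x y : V) :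
  definable A r (fun H e => ~ adj (e x) (e y)).
Proof. by exists (Neg (Adj x y)); split=> //= [|H e]; [rewrite A0|split=> /negP]. Qed.

(** Formulas have no constant for truth; a variable [v] provides the tautology [v = v]. *)
Lemma definable_true (v : V) (r : nat) P :
  (forall H e, P H e) -> definable A r P.
Proof.
move=> PT; apply: definable_ext (definable_eq r v v) => H e.
by split=> // _; exact: PT.
Qed.

Lemma definable_false (v : V) (r : nat) P :
  (forall H e, ~ P H e) -> definable A r P.
Proof.
move=> PT; apply: definable_ext (definable_neq r v v) => H e.
by split=> // /PT.
Qed.

Lemma definable_forall_in (v : V) (r : nat) (I : eqType) (s : seq I)
    (P : I -> forall H : sgraph, (V -> H) -> Prop) :
  (forall i, i \in s -> definable A r (P i)) ->
  definable A r (fun H e => forall i, i \in s -> P i H e).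
Proof.
elim: s => [_|i s IH Ps]; first exact: definable_true.
have Pi := Ps i (mem_head i s).
have Ps' j : j \in s -> definable A r (P j).
  by move=> js; apply: Ps; rewrite inE js orbT.
apply: definable_ext (definable_and Pi (IH Ps')) => H e; split.
  by move=> [Pie Pse] j /predU1P[-> //|/Pse].
by move=> Pse; split=> [|j js]; apply: Pse; rewrite inE ?eqxx ?js ?orbT.
Qed.

Lemma definable_exists_in (v : V) (r : nat) (I : eqType) (s : seq I)
    (P : I -> forall H : sgraph, (V -> H) -> Prop) :
  (forall i, i \in s -> definable A r (P i)) ->
  definable A r (fun H e => exists2 i, i \in s & P i H e).
Proof.
elim: s => [_|i s IH Ps].
  by apply: definable_false => // H e [].
have Pi := Ps i (mem_head i s).
have Ps' j : j \in s -> definable A r (P j).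
  by move=> js; apply: Ps; rewrite inE js orbT.
apply: definable_ext (definable_or Pi (IH Ps')) => H e; split.
  move=> [Pie|[j js Pje]]; [exists i|exists j]; rewrite ?inE ?eqxx ?js ?orbT //.
by move=> [j /predU1P[->|js] Pje]; [left|right; exists j].
Qed.

End Definability.

(** A block of existential quantifiers reassigns the variables in [s]: each takes over one [x],
    which [h] renames to the bound variable. *)
Lemma definable_ex_off (A : pred (seq bool)) (V : eqType) (s : seq V) (r : nat)
    (P : forall H : sgraph, (V -> H) -> Prop) :
  (forall w, A w -> A (true :: w)) -> definable A r P ->
  definable A (size s + r)
    (fun H e => exists2 e' : V -> H, {in [predC s], e' =1 e} & P H e').
Proof.
move=> AE Pdef; elim: s => [|x s IH].
  case: Pdef => F [Fr FA FP]; exists F; split=> // H e; rewrite FP.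
  split=> [Pe|[e' e'e /FP Pe']]; first by exists e.
  by apply/FP; rewrite (@eq_eval _ _ _ e e') // => y; rewrite e'e.
pose h y := if y == x then None else Some y.
have := definable_ex AE (definable_rename h IH); apply: definable_ext => H e.
split=> [[a [e' e'e Pe']]|[e' e'e Pe']].
  exists e' => // y; rewrite !inE negb_or => /andP[/negPf yx ys].
  by rewrite e'e // /= /h yx.
exists (e' x); exists e' => // y ys; rewrite /= /h; case: eqP => [-> //|/eqP yx].
by rewrite /= e'e // !inE negb_or yx.
Qed.

(** * Local bijectivity and its definition by a formula *)

(** Required at every vertex [x], this makes [f] a covering of graphs. *)
Definition locally_bijective_at (G H : sgraph) (f : G -> H) (x : G) : Prop :=
  [/\ forall y, adj x y -> adj (f x) (f y),
      forall y z, adj x y -> adj x z -> f y = f z -> y = z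
    & forall b, adj (f x) b -> exists2 y, adj x y & b = f y].

Lemma eq_locally_bijective_at (G H : sgraph) (f g : G -> H) (x : G) :
  f x = g x -> (forall y, adj x y -> f y = g y) ->
  locally_bijective_at f x -> locally_bijective_at g x.
Proof.
move=> fgx fg [fadj finj fsur]; split.
- by move=> y xy; rewrite -fgx -fg //; apply: fadj.
- by move=> y z xy xz; rewrite -!fg //; apply: finj.
- move=> b; rewrite -fgx => /fsur[y xy ->]; exists y => //; exact: fg.
Qed.

Lemma locally_bijective_at_id (G : sgraph) (x : G) : locally_bijective_at id x.
Proof. by split=> // b; exists b. Qed.

(* The words of the form [true^i false^j]. *)
Definition ex_all_word : pred (seq bool) := sorted (fun a b => b ==> a).

Lemma ex_all_word_cons (s : seq bool) :
  ex_all_word s -> ex_all_word (true :: s).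
Proof. by case: s => //= a s ->; rewrite implybT. Qed.

Lemma alternations_ex_all_word (s : seq bool) :
  ex_all_word s -> alternations s <= 1.
Proof.
have al0 t : path (fun a b => b ==> a) false t -> alternations (false :: t) = 0.
  by elim: t => //= -[].
elim: s => // -[] [|[] s] IH hs //.
- by rewrite [alternations _]add0n IH.
- by rewrite -[alternations _]/(1 + alternations (false :: s)) al0.
- by rewrite al0.
Qed.

(** The vertices of [G] serve as variables, so the first two clauses are finite conjunctions without
    quantifiers. Only local surjectivity quantifies over [H]. *)
Lemma definable_locally_bijective_at (G : sgraph) (x : G) :
  definable ex_all_word 1 (fun H (e : G -> H) => locally_bijective_at e x).
Proof.
pose N := enum (adj x).
have NE y : (y \in N) = adj x y by rewrite mem_enum.
have d1 : definable ex_all_word 1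
    (fun H (e : G -> H) => forall y, y \in N -> adj (e x) (e y)).
  by apply: definable_forall_in => // y _; apply: definable_adj.
have d2 : definable ex_all_word 1 (fun H (e : G -> H) =>
    forall y, y \in N -> forall z, z \in [seq z <- N | z != y] -> e y <> e z).
  apply: definable_forall_in => // y _.
  by apply: definable_forall_in => // z _; apply: definable_neq.
have d3 : definable ex_all_word 1 (fun H (e : G -> H) =>
    forall b : H, ~ adj (e x) b \/ exists2 y, y \in N & b = e y).
  pose P (H : sgraph) (e : option G -> H) := ~ adj (e (Some x)) (e None) \/
    exists2 y, y \in N & e None = e (Some y).
  (* A universal letter may be prefixed here because the body is quantifier-free, hence the word
     predicate [nilp]. *)
  apply: (@definable_all (@nilp bool) _ ex_all_word 0 P) => [[] //|].
  apply: definable_or; first exact: definable_nadj.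
  by apply: (definable_exists_in _ (Some x)) => // y _; apply: definable_eq.
apply: definable_ext (definable_and d1 (definable_and d2 d3)) => H e; split.
  move=> [h1 [h2 h3]]; split=> [y|y z|b].
  - by rewrite -NE; apply: h1.
  - rewrite -!NE => yN zN eyz; apply/eqP; apply: contraT => yz.
    by case: (h2 y yN z _ eyz); rewrite mem_filter eq_sym yz.
  - by case: (h3 b) => // -[y]; rewrite NE; exists y.
move=> [h1 h2 h3]; split=> [y|]; first by rewrite NE; apply: h1.
split=> [y|b].
  rewrite NE => xy z; rewrite mem_filter NE => /andP[zy xz] /h2 yz.
  by rewrite yz ?eqxx in zy.
have [/h3[y xy ->]|] := boolP (adj (e x) b); last by left; apply/negP.
by right; exists y; rewrite ?NE.
Qed.

(** * Separators in acyclic graphs *)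

Section Separator.
Variables (G : sgraph) (C : {set G}).

Definition adj_del (c : G) : rel G :=
  [rel x y | [&& adj x y, x \in C :\ c & y \in C :\ c]].

Lemma adj_del_sym (c : G) : symmetric (adj_del c).
Proof. by move=> x y; rewrite /adj_del /= adj_sym; congr (_ && _); apply: andbC. Qed.

Lemma connect_adj_del_sym (c : G) : connect_sym (adj_del c).
Proof. exact/sym_connect_sym/adj_del_sym. Qed.

(** For [y] in [C :\ c], this is the component of [y] in the subgraph induced there. *)
Definition branch (c y : G) : {set G} := [set z | connect (adj_del c) y z].

Lemma branch_sub (c y : G) (D : {set G}) :
  y \in D -> (forall u v, u \in D -> adj_del c u v -> v \in D) ->
  branch c y \subset D.
Proof.
move=> yD Dcl; apply/subsetP => z; rewrite inE => /connectP[p].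
elim: p y yD => [|v p IH] y yD /= => [_ -> //|/andP[yv vp]].
by apply: IH vp; apply: Dcl yv.
Qed.

Lemma branch_subD1 (c y : G) : y \in C :\ c -> branch c y \subset C :\ c.
Proof. by move=> yC; apply: branch_sub => // u v _ /and3P[]. Qed.

(** If [u] and [w] differed, a simple path between them avoiding [c] would close up through [c] to a
    cycle. *)
Lemma acyclic_branch_adj (c u w : G) : is_acyclic G ->
  adj c u -> adj c w -> connect (adj_del c) u w -> u = w.
Proof.
move=> Gac cu cw /connectP[p0 up0 Ew]; apply/eqP; apply: contraT => uw.
rewrite {w}Ew in cw uw; case/shortenP: up0 cw uw => p up Up _ cw uw.
have pc : c \notin p.
  elim: p u up {cu Up cw uw} => //= v p IH u /andP[/and3P[_ _ vC] vp].
  by rewrite inE negb_or (IH v) // andbT; move: vC; rewrite !inE eq_sym => /andP[].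
case: (Gac (c :: u :: p)).
  by case: p uw {up Up cw pc} => //=; rewrite eqxx.
apply/andP; split.
  rewrite /= cu rcons_path adj_sym cw andbT /=.
  by apply: sub_path up => x y /and3P[].
rewrite /= -/(uniq (u :: p)) Up andbT inE negb_or pc andbT.
by apply: contraL cu => /eqP ->; rewrite adj_irrefl.
Qed.

(** Choose [c] so that its largest branch is as small as possible. If a branch had more than half of
    [C], some vertex of it would be a better choice. *)
Lemma separator : is_acyclic G -> C != set0 ->
  exists2 c, c \in C & forall y, y \in C :\ c -> #|branch c y|.*2 <= #|C|.
Proof.
move=> Gac /set0Pn[c0 c0C].
pose M c := \max_(y in C :\ c) #|branch c y|.
have [c cC Mmin] := arg_minnP M c0C; exists c => // y yC.
set D := branch c y; rewrite leqNgt; apply/negP => ltCD.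
have DC : D \subset C by apply: subset_trans (branch_subD1 yC) (subsetDl _ _).
have yD : y \in D by rewrite inE connect0.
have Dstep u v : u \in D -> v \in C -> v != c -> adj u v -> v \in D.
  move=> uD vC vc uv; have uCc := subsetP (branch_subD1 yC) u uD.
  rewrite inE; move: uD; rewrite inE => yu; apply: connect_trans yu (connect1 _).
  by apply/and3P; split=> //; rewrite !inE vc.
(* The branch [D] meets the neighbourhood of [c] in at most one vertex [c'];
   moving from [c] to [c'] leaves only branches smaller than [D]. *)
have [c' c'D c'P] : exists2 c', c' \in D &
    forall u v, u \in D -> v \in C -> adj u v -> u != c' -> v \in D.
  have [/existsP[c' /andP[c'D cc']]|noc] := boolP [exists z in D, adj c z].
    exists c' => // u v uD vC uv uc'; apply: (Dstep u) => //.
    apply: contraNneq uc' => vc; apply/eqP.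
    apply: (@acyclic_branch_adj c) => //; first by rewrite adj_sym -vc.
    move: uD c'D; rewrite !inE connect_adj_del_sym; exact: connect_trans.
  (* If [c] has no neighbour in [D], no edge inside [C] leaves [D], and any vertex of [D] serves as
     [c']. *)
  exists y => // u v uD vC uv _; apply: (Dstep u) => //.
  apply: contraNneq noc => vc; apply/existsP; exists u.
  by rewrite uD adj_sym -vc.
have /Mmin : c' \in C by apply: (subsetP DC).
rewrite leqNgt => /negP[]; apply: (@leq_trans #|D|); last exact: leq_bigmax_cond.
have D_gt0 : 0 < #|D| by apply/card_gt0P; exists y.
rewrite -(prednK D_gt0) ltnS; apply/bigmax_leqP => z zC.
rewrite -ltnS (prednK D_gt0).
(* A branch at [c'] starting in [D] stays in [D :\ c']. One starting outside stays in [C :\: D],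
   which is smaller than [D] because [D] fills more than half of [C]. *)
have [zD|zD] := boolP (z \in D).
  apply: (@leq_ltn_trans #|D :\ c'|); last exact/proper_card/properD1.
  apply/subset_leq_card/branch_sub; first by move: zC; rewrite !in_setD1 zD => /andP[->].
  move=> u v /setD1P[uc' uD] /and3P[uv _ /setD1P[vc' vC]].
  by rewrite in_setD1 vc' (c'P u).
apply: (@leq_ltn_trans #|C :\: D|); last first.
  by rewrite cardsD (setIidPr DC) ltn_subLR ?subset_leq_card // addnn.
apply/subset_leq_card/branch_sub; first by move: zC; rewrite in_setD1 in_setD zD => /andP[].
move=> u v /setDP[uC uD] /and3P[uv _ /setD1P[vc' vC]].
rewrite in_setD vC andbT; apply: contra uD => vD.
by apply: (c'P v) => //; rewrite adj_sym.
Qed.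

End Separator.

(** * The covering expressed by divide and conquer *)

(** [K] will collect the separators chosen so far; the vertices of its closed neighbourhood are
    those whose images are already fixed. *)
Definition nbhd (G : sgraph) (K : {set G}) : {set G} :=
  [set x | (x \in K) || [exists y in K, adj y x]].

(* The separator [c] and its neighbours are quantified together, so that the
   condition at [c] can be stated at once; the branches at [c] then interact
   only through vertices that have already received their images. *)
Lemma definable_local_bijection (G : sgraph) (d k : nat) (K C : {set G})
    (v : G) :
  is_acyclic G -> (forall x : G, degree x <= d) ->
  [disjoint C & K] -> (forall x y, x \in C -> adj x y -> y \in C :|: K) ->
  #|C| < 2 ^ k ->
  definable ex_all_word (d.+1 * k).+1 (fun H (e : G -> H) =>
    exists2 g : G -> H, {in nbhd K, g =1 e}
      & forall x, x \in C -> locally_bijective_at g x).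
Proof.
move=> Gac Gd; elim: k K C => [|k IH] K C CK Ccl ltC.
  apply: definable_true => // H e; exists e => // x.
  by move: ltC; rewrite ltnS leqn0 cards_eq0 => /eqP->; rewrite inE.
have [C0|Cn0] := eqVneq C set0.
  by apply: definable_true => // H e; exists e => // x; rewrite C0 inE.
have [c cC cP] := separator Gac Cn0.
(* Only [c] and its neighbours without a fixed image are quantified, at most [d + 1] variables. *)
pose s := enum (nbhd (c |: K) :\: nbhd K).
have nbhdU x : (x \in nbhd (c |: K)) = [|| x == c, adj c x | x \in nbhd K].
  rewrite !inE; apply/idP/idP.
    case/orP=> [/orP[->//|->]|/existsP[y /andP[]]]; first by rewrite !orbT.
    rewrite !inE => /predU1P[->|yK] yx; first by rewrite yx orbT.
    by apply/or3P/Or33/orP; right; apply/existsP; exists y; rewrite yK.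
  case/or3P=> [->//|cx|/orP[->|/existsP[y /andP[yK yx]]]].
  - by apply/orP; right; apply/existsP; exists c; rewrite !inE eqxx.
  - by rewrite orbT.
  - by apply/orP; right; apply/existsP; exists y; rewrite !inE yK orbT.
have size_s : size s <= d.+1.
  rewrite -cardE; apply: (@leq_trans #|c |: [set y | adj c y]|).
    apply/subset_leq_card/subsetP => x; rewrite in_setD nbhdU => /andP[/negPf->].
    by rewrite orbF !inE.
  by rewrite (leq_trans (leq_card_setU _ _)) // cards1 add1n ltnS; apply: Gd.
have nc x : x \in C -> x \notin K by move=> xC; rewrite (disjointFr CK).
pose P y (H : sgraph) (e : G -> H) := exists2 g : G -> H,
  {in nbhd (c |: K), g =1 e} &
  forall x, x \in branch C c y -> locally_bijective_at g x.
(* Induction applies with [c] joined to [K]: an edge leaving the branch ends in [c] or in [K]. *)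
have Pdef y : y \in enum (C :\ c) -> definable ex_all_word (d.+1 * k).+1 (P y).
  rewrite mem_enum => yC; have /subsetP yCc := branch_subD1 yC.
  apply: IH => //.
  - rewrite disjoint_subset; apply/subsetP => x /yCc /setD1P[xc xC].
    by rewrite !inE negb_or xc nc.
  - move=> x z xy xz; have /setD1P[xc xC] := yCc x xy.
    have := Ccl x z xC xz; rewrite !inE.
    have [//|zc] := eqVneq z c; first by rewrite orbT.
    case/orP=> [zC|->]; last by rewrite !orbT.
    have yx : connect (adj_del C c) y x by move: xy; rewrite inE.
    by rewrite (connect_trans yx) // connect1 // /adj_del /= xz !inE xc xC zc.
  - by rewrite -ltn_double -[(2 ^ k).*2]mul2n -expnS (leq_ltn_trans (cP y yC)).
have := definable_ex_off s ex_all_word_cons (definable_and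
  (definable_sub (fun _ => id) (ltn0Sn (d.+1 * k))
     (definable_locally_bijective_at c))
  (definable_forall_in isT v Pdef)).
have rank_le : size s + (d.+1 * k).+1 <= (d.+1 * k.+1).+1.
  by rewrite mulnS -addnS leq_add2r.
move=> /(definable_sub (fun _ => id) rank_le); apply: definable_ext => H e.
split=> [[e' e'e [e'c /= eP]]|[g ge gC]].
  have /fin_all_exists[g gP] (y : G) : exists g : G -> H, y \in C :\ c ->
      {in nbhd (c |: K), g =1 e'} /\
      forall x, x \in branch C c y -> locally_bijective_at g x.
    case: (boolP (y \in C :\ c)) => [yC|_]; last by exists e'.
    by have [|g] := eP y; [rewrite mem_enum | exists g].
  (* Several [y] may yield the same branch; the root selects one extension per branch, which makes
     the glued map consistent. *)
  pose rt x := fingraph.root (adj_del C c) x.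
  have rtC x : x \in C :\ c -> rt x \in C :\ c.
    move=> xC; apply: (subsetP (branch_subD1 xC)); rewrite inE; exact: connect_root.
  exists (fun x => if x \in C :\ c then g (rt x) x else e' x) => [x xK|x xC].
    have ex : e' x = e x by rewrite e'e // inE /= mem_enum in_setD xK.
    case: ifP => // /rtC /gP[-> //]; by rewrite nbhdU xK !orbT.
  have [xc|xc] := eqVneq x c.
    rewrite {}xc; apply: eq_locally_bijective_at e'c; first by rewrite !inE eqxx.
    by move=> y cy; case: ifP => // /rtC /gP[-> //]; rewrite nbhdU cy orbT.
  have xCc : x \in C :\ c by rewrite !inE xc.
  have [gx gb] := gP _ (rtC x xCc).
  have /gb : x \in branch C c (rt x).
    by rewrite inE connect_adj_del_sym connect_root.
  apply: eq_locally_bijective_at => [|y xy]; first by rewrite xCc.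
  have := Ccl x y xC xy; case: ifP => [yCc _|/negbT yCc yCK].
    congr (g _ _); apply/eqP; rewrite root_connect; last exact: connect_adj_del_sym.
    by apply: connect1; rewrite /adj_del /= xy xCc.
  (* A neighbour outside the branches is [c] or lies in [K], where every extension agrees with
     [e']. *)
  rewrite gx // nbhdU !inE; move: yCc yCK; rewrite !inE.
  by case: eqP => //= _ /negPf-> /= ->; rewrite orbT.
(* The quantified block may change [e] only on [s], so [g] is used there alone; on [nbhd (c |: K)]
   the result still equals [g]. *)
exists (fun x => if x \in s then g x else e x) => [x|].
  by rewrite inE => /negPf->.
have ge' x : x \in nbhd (c |: K) -> g x = if x \in s then g x else e x.
  rewrite mem_enum in_setD => xcK; rewrite xcK andbT.
  by case: (boolP (x \in nbhd K)) => // /ge.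
split=> /=.
  apply: eq_locally_bijective_at (gC c cC) => [|y cy]; apply: ge'.
    by rewrite nbhdU eqxx.
  by rewrite nbhdU cy orbT.
move=> y; rewrite mem_enum => yC; exists g => // x.
by move=> /(subsetP (branch_subD1 yC)) /setD1P[_ /gC].
Qed.

(** * Coverings of connected graphs by trees *)

(** This will show that the lift of a cycle has at least three vertices. *)
Lemma next_next_neq (T : eqType) (c : seq T) (b : T) :
  uniq c -> 2 < size c -> b \in c -> next c b != b /\ next c (next c b) != b.
Proof.
move=> Uc c_gt2 bc; have [i c' Ec] := rot_to bc.
have := c_gt2; rewrite -(size_rot i) Ec; case: c' Ec => [|v [|w c']] // Ec _.
have := Uc; rewrite -(rot_uniq i) Ec => /=; rewrite !inE !negb_or.
move=> /andP[/and3P[bv bw _] _].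
rewrite -!(next_rot i Uc) Ec /= eqxx (eq_sym v b) (negPf bv) eqxx.
by split; rewrite // eq_sym.
Qed.

Section Covering.
Variables (G H : sgraph) (f : G -> H).
Hypothesis f_cov : forall x, locally_bijective_at f x.

(* Following the lifts of a cycle of [H] permutes its preimage, and an orbit
   of this permutation is a cycle of [G]. *)
Lemma covering_acyclic :
  is_acyclic G -> (forall b, exists x, f x = b) -> is_acyclic H.
Proof.
move=> Gac f_surj c c_gt2 /andP[adj_c Uc].
(* [t] lifts one step along [c]; off the preimage of [c] it is the identity, so that it is total and
   can be shown to be a permutation. *)
have /fin_all_exists[t tP] (x : G) : exists y,
    if f x \in c then adj x y /\ f y = next c (f x) else y = x.
  have [xc|_] := boolP (f x \in c); last by exists x.
  have [_ _ fsur] := f_cov x.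
  by have [y xy Ey] := fsur _ (next_cycle adj_c xc); exists y.
have tC x : f x \in c -> adj x (t x) /\ f (t x) = next c (f x).
  by move=> xc; have := tP x; rewrite xc.
have tmem x : (f (t x) \in c) = (f x \in c).
  case: (boolP (f x \in c)) (tP x) => [xc [_ ->]|/negPf xc ->] //.
  by rewrite mem_next.
have t_inj : injective t.
  move=> x y txy; have := tmem x; rewrite txy tmem => xyc.
  case: (boolP (f x \in c)) => xc; last first.
    by have := tP x; have := tP y; rewrite xyc (negPf xc) txy => -> ->.
  have [xt ftx] := tC x xc; have [yt fty] : adj y (t y) /\ f (t y) = next c (f y).
    by apply: tC; rewrite xyc.
  (* Both [x] and [y] are neighbours of [t y] lying over the predecessor of [f (t y)] in [c], so
     local injectivity identifies them. *)
  rewrite txy in xt ftx; have [_ finj _] := f_cov (t y).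
  apply: finj; rewrite ?[adj (t y) _]adj_sym //.
  by apply: (can_inj (prev_next Uc)); rewrite -ftx.
have [b bc] : exists b, b \in c.
  by case: c c_gt2 {adj_c Uc tP tC tmem} => // b c; exists b; rewrite mem_head.
have [x fx] := f_surj b.
have itc i : f (iter i t x) \in c by elim: i => [|i IH] /=; rewrite ?fx ?tmem.
have [nb nnb] := next_next_neq Uc c_gt2 bc.
have ft1 : f (t x) = next c b by have [|_ ->] := tC x; rewrite fx.
have ft2 : f (t (t x)) = next c (next c b).
  by have [|_ ->] := tC (t x); rewrite ?tmem ?ft1 ?fx.
apply: (Gac (orbit t x)).
  rewrite size_orbit; have := iter_order t_inj x; have := order_gt0 t x.
  case: (order t x) => [|[|[|m]]] //= _ E; first by rewrite -ft1 E fx eqxx in nb.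
  by rewrite -ft2 E fx eqxx in nnb.
rewrite /ucycle orbit_uniq andbT.
apply: (@sub_in_cycle _ [pred y | f y \in c] _ _ _ _ _ (cycle_orbit t_inj x)).
  by move=> y z yc _ /eqP <-; have [] := tC y yc.
by apply/allP => y /trajectP[i _ ->]; apply: itc.
Qed.

(** By induction the images of the tail are distinct. If [f x] equalled the image of a later [z],
    the segment from [x] to [z] would map to a cycle of [H]. *)
Lemma covering_path_uniq (x : G) (p : seq G) : is_acyclic H ->
  path (@adj G) x p -> uniq (x :: p) -> uniq [seq f y | y <- x :: p].
Proof.
move=> Hac; have fadj y z : adj y z -> adj (f y) (f z).
  by have [+ _ _] := f_cov y; apply.
have fpath y q : path (@adj G) y q -> path (@adj H) (f y) (map f q).
  by elim: q y => //= z q IH y /andP[/fadj -> /IH].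
elim: p x => // y p IH x xyp; have /andP[xy yp] := xyp.
move=> Uxyp; have /andP[_ Uyp] := Uxyp.
rewrite map_cons cons_uniq (IH y) // andbT; apply/negP => /mapP[z zyp fxz].
have := IH y yp Uyp; move: xyp Uxyp {IH xy yp Uyp}.
case/path.splitP: zyp fxz => p1 p2 fxz; rewrite cat_path => /andP[xp1 _] Uxp.
rewrite map_cat cat_uniq => /andP[Up1 _].
apply: (Hac (map f (rcons p1 z))); last first.
  apply/andP; split=> //; have := fpath _ _ xp1.
  by rewrite (cycle_path (f z)) map_rcons last_rcons fxz.
(* Length one would give a loop, and length two contradicts local injectivity at the middle vertex
   [a]. *)
case: p1 xp1 Uxp {Up1} => [|a [|b p1]] /=.
- by rewrite andbT => /fadj; rewrite fxz adj_irrefl.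
- rewrite andbT adj_sym !inE !negb_or => /andP[ax az] /andP[/and3P[_ xz _] _].
  by have [_ finj _] := f_cov a; case/eqP: xz; apply: finj.
- by rewrite size_map size_rcons.
Qed.

(** Lifting paths gives surjectivity, hence [H] is acyclic; then the simple path joining two
    vertices with the same image must be trivial, which gives injectivity. *)
Lemma covering_isomorphic : is_tree G ->
  (forall a b : H, connect (@adj H) a b) -> isomorphic G H.
Proof.
move=> [[/card_gt0P[x0 _] Gconn] Gac] Hconn.
have f_surj b : exists x, f x = b.
  have /connectP[p] := Hconn (f x0) b.
  elim: p x0 => /= [x _ ->|a p IH x /andP[xa ap] Eb]; first by exists x.
  have [_ _ /(_ _ xa)[y _ ya]] := f_cov x.
  by apply: (IH y); rewrite -ya.
have Hac := covering_acyclic Gac f_surj.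
have f_inj : injective f.
  move=> x y fxy; have /connectP[p0 xp0 Ey] := Gconn x y.
  move: fxy; rewrite {y}Ey; case/shortenP: xp0 => p xp Up _.
  have := covering_path_uniq Hac xp Up; case: p {xp Up} => //= z p /andP[+ _].
  move=> /negP h fx; case: h; rewrite fx -map_cons; exact/map_f/mem_last.
exists f.
  have /fin_all_exists[g gP] := f_surj.
  by exists g => // x; apply: f_inj; rewrite gP.
move=> x y; have [fadj _ fsur] := f_cov x; apply/idP/idP => [|/fadj//].
by move=> /fsur[z xz /f_inj->].
Qed.

End Covering.

(** * Defining connectedness *)

Definition within (H : sgraph) (m : nat) (x y : H) : Prop :=
  exists p : seq H, [/\ path (@adj H) x p, last x p = y & size p <= m].

(** Guessing a midpoint doubles the reachable length at the cost of one existential quantifier. *)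
Lemma definable_within (V : Type) (k : nat) (x y : V) :
  definable (all id) k (fun H (e : V -> H) => within (2 ^ k) (e x) (e y)).
Proof.
elim: k V x y => [|k IH] V x y.
  apply: definable_ext (definable_or (definable_eq _ 0 x y) (definable_adj _ 0 x y)) => //.
  move=> H e; split=> [[<-|xy]|[[|z [|? ?]] []]] /=.
  - by exists [::].
  - by exists [:: e y]; rewrite /= xy.
  - by left.
  - by rewrite andbT => + <-; right.
  - by [].
pose P (H : sgraph) (e : option V -> H) :=
  within (2 ^ k) (e (Some x)) (e None) /\ within (2 ^ k) (e None) (e (Some y)).
have := @definable_ex (all id) V (all id) k P (fun s => id)
  (definable_and (IH _ _ _) (IH _ _ _)).
apply: definable_ext => H e; split.
  move=> [z [[p [xp pz pk]] [q [zq qy qk]]]]; exists (p ++ q).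
  rewrite cat_path last_cat size_cat xp pz zq qy.
  by rewrite expnS mul2n -addnn leq_add.
(* If [p] has at most [2 ^ k] edges, the chosen midpoint is its end and the second half is empty. *)
move=> [p [xp py pk]]; exists (last (e x) (take (2 ^ k) p)).
move: xp py; rewrite -{1 2}(cat_take_drop (2 ^ k) p) cat_path last_cat.
move=> /andP[xp pd] dy; split.
  by exists (take (2 ^ k) p); split=> //; rewrite size_take_min geq_minl.
exists (drop (2 ^ k) p); split=> //.
by rewrite size_drop leq_subLR addnn -mul2n -expnS.
Qed.

Definition alternations_le (m : nat) : pred (seq bool) := fun s => alternations s <= m.

(** The quantifier words are two universal letters followed by existential ones. *)
Lemma definable_connected (V : Type) (k : nat) :
  definable (alternations_le 2) k.+2
    (fun H (e : V -> H) => forall x y : H, within (2 ^ k) x y).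
Proof.
have d1 := @definable_within (option (option V)) k (Some None) None.
pose Q (H : sgraph) (e : option V -> H) := forall b : H, within (2 ^ k) (e None) b.
have d2 : definable (fun s => if s is false :: t then all id t else false) k.+1 Q.
  exact: definable_ext (definable_all (fun s => id) d1).
apply: (definable_all _ d2) => -[|[] s] // h; rewrite /alternations_le /= add0n.
by case: s h => [|b s] //= /andP[-> ]; elim: s b => //= -[] s IH // _ /IH; apply.
Qed.

(** * The defining sentence of a tree *)

Lemma definable_with_tree (G : sgraph) (d k : nat) :
  is_tree G -> max_degree G <= d -> #|G| < 2 ^ k ->
  exists2 q, q <= (d.+1 * k).+2 & definable_with 2 q G.
Proof.
move=> Gtree Gd Gk; have [[/card_gt0P[v _] Gconn] Gac] := Gtree.
have deg_le (x : G) : degree x <= d.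
  by apply: leq_trans Gd; apply: (leq_bigmax x).
have cov : definable ex_all_word (d.+1 * k).+1 (fun H (e : G -> H) =>
    exists2 g : G -> H, {in nbhd set0, g =1 e}
      & forall x, x \in [set: G] -> locally_bijective_at g x).
  apply: definable_local_bijection => //; last by rewrite cardsT.
  - by rewrite disjoint_sym disjoints_subset sub0set.
  - by move=> x y _ _; rewrite inE in_setT.
(* A closed formula has no assignment to start from: one more existential quantifier gives all
   variables a common arbitrary value. It imposes nothing, as [nbhd set0] is empty. *)
pose h (x : G) : option void := None.
have ex_all_le2 : subpred ex_all_word (alternations_le 2).
  by move=> s /alternations_ex_all_word /leq_trans; apply.
have le_k : k.+2 <= (d.+1 * k).+2 by rewrite !ltnS leq_pmull.
have [F [Fr FA FP]] := definable_and
  (definable_sub ex_all_le2 (leqnn _)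
    (definable_ex ex_all_word_cons (definable_rename h cov)))
  (definable_sub (fun _ => id) le_k (definable_connected void k)).
exists (quantifier_rank F) => //; exists F; split=> //; last first.
  by rewrite /alternation_number big_tnth; apply/bigmax_leqP => i _;
    move/allP: FA; apply; apply: mem_tnth.
split=> [|H niso].
  apply/FP; split=> [|x y].
    exists v, id => [x|x _]; last exact: locally_bijective_at_id.
    by rewrite inE in_set0 => /existsP[y]; rewrite in_set0.
  (* A simple path in [G] has fewer than [2 ^ k] edges. *)
  have /connectP[p xp ->] := Gconn x y; case/shortenP: xp => p' xp' Up' _.
  exists p'; split=> //; apply: leq_trans (ltnW Gk).
  by have := max_card (mem (x :: p')); rewrite (card_uniqP Up'); apply: ltnW.
apply/negP => /FP[[a [g _ gcov]] conn]; apply: niso.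
apply: (@covering_isomorphic _ _ g) => // [x|x y]; first by apply: gcov; rewrite in_setT.
by have [p [xp <- _]] := conn x y; apply/connectP; exists p.
Qed.

Lemma is_D_exists (k r : nat) (G : sgraph) :
  definable_with k r G -> exists2 q, is_D k G q & q <= r.
Proof.
move=> Gr; have exP : exists q, `[< definable_with k q G >] by exists r; apply/asboolP.
case: (ex_minnP exP) => q /asboolP Gq qmin; exists q; last exact/qmin/asboolP.
by split=> // s Gs; apply/qmin/asboolP.
Qed.

Lemma max_degree_lt (G : sgraph) : 0 < #|G| -> max_degree G < #|G|.
Proof.
move=> G_gt0; rewrite -(prednK G_gt0) ltnS; apply/bigmax_leqP => x _.
rewrite -ltnS (prednK G_gt0) -cardsT; apply/proper_card/properP; split.
  exact: subsetT.
by exists x; rewrite ?in_setT // inE adj_irrefl.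
Qed.

(** * The numerical bound *)

Local Open Scope ring_scope.

(** Since [log2 (3 / 2) <= 1] and [k <= log2 n], the term [(d + 1) k] is at most
    [(d + 1) / log2 (3 / 2)] times [log2 n]. The summand 1 of [c_] contributes another [log2 n],
    which exceeds 1 as [n > 2] and makes the inequality strict. *)
Lemma rank_bound (R : realType) (d n k : nat) :
  (2 < n)%N -> (2 ^ k <= n)%N ->
  ((d.+1 * k.+1).+2%:R : R) < c_ R d * log2 (n%:R : R) + d%:R + 2.
Proof.
move=> n_gt2 kn; set t := log2 _.
have ln2_gt0 : 0 < ln (2 : R) by apply: ln_gt0; lra.
have n_gt0 : 0 < (n%:R : R) by rewrite ltr0n (ltn_trans _ n_gt2).
have t_gt1 : 1 < t.
  by rewrite ltr_pdivlMr // mul1r ltr_ln ?posrE // ltr_nat.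
have kt : k%:R <= t.
  rewrite ler_pdivlMr // mulr_natl -lnXn // ler_ln ?posrE ?exprn_gt0 //.
  by rewrite -natrX ler_nat.
have a_gt0 : 0 < log2 (3 / 2 : R) by apply: divr_gt0 => //; apply: ln_gt0; lra.
have a_le1 : log2 (3 / 2 : R) <= 1.
  by rewrite ler_pdivrMr // mul1r ler_ln ?posrE; lra.
have ct : (d%:R + 1) * t <= (d%:R + 1) / log2 (3 / 2 : R) * t.
  rewrite ler_wpM2r ?(ltW (lt_trans ltr01 t_gt1)) //.
  by rewrite ler_peMr ?addr_ge0 // invf_ge1.
have dk : (d%:R + 1) * k%:R <= (d%:R + 1) * t.
  by rewrite ler_wpM2l // addr_ge0.
rewrite -[(_ * _).+2]addn2 natrD natrM -addn1 -[k.+1]addn1 !natrD /c_.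
lra.
Qed.

Theorem theorem4p1 (R : realType) (d n : nat) (G : sgraph)
    (d_ge2 : (2 <= d)%N) (G_tree : is_tree G)
    (G_order : #|G| = n) (G_degree : max_degree G = d) :
  exists q : nat, is_D 2 G q /\
    (q%:R : R) < c_ R d * log2 (n%:R : R) + d%:R + 2.
Proof.
have n_gt2 : (2 < n)%N.
  have [[G_gt0 _] _] := G_tree.
  by rewrite -G_order (leq_ltn_trans d_ge2) // -G_degree max_degree_lt.
(* With [k] the integer part of [log2 n], [k + 1] rounds of halving suffice, as [n < 2 ^ k.+1]. *)
pose k := trunc_log 2 n.
have /andP[kn nk] : (2 ^ k <= n < 2 ^ k.+1)%N.
  by apply: trunc_log_bounds => //; apply: leq_trans n_gt2.
have [||r rk Gr] := @definable_with_tree G d k.+1 G_tree.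
- by rewrite G_degree.
- by rewrite G_order.
have [q Dq qr] := is_D_exists Gr; exists q; split=> //.
apply: le_lt_trans (rank_bound R d n_gt2 kn).
by rewrite ler_nat (leq_trans qr).
Qed.
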